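(* For all $n \in \mathbb{Z}^+$, \[ \log_2 \Upsilon_{n,n} \ge \frac{2n}{\log_q n}\cdot\left(1 - O\!\left(\frac{1}{\log_q n}\right)\right), \] where the constant hidden in the $O(\cdot)$ term is absolute (independent of $n$ and $q$).
   Context: $\mathbb{F}$ is a finite field with $q$ elements. $\mathcal{P}_n$ denotes the set of monic polynomials in $\mathbb{F}[x]$ of degree at most $n$. For $s \in \mathcal{P}_{2n}$, $\Phi_n(s)$ is the number of ordered pairs $(u,v) \in \mathcal{P}_n \times \mathcal{P}_n$ with $s = u\cdot v$ (the number of $(n,n)$-factorizations of $s$). Define $\Upsilon_{n,n} = \max_{s \in \mathcal{P}_{2n}} \Phi_n(s)$. *)

(* Defs.v *)
From mathcomp Require Import all_boot all_order all_algebra qpoly.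
From mathcomp Require Import reals exp.

Set Implicit Arguments.
Unset Strict Implicit.
Unset Printing Implicit Defensive.

Import Order.TTheory GRing.Theory Num.Theory.

Local Open Scope ring_scope.

(* {poly_n.+1 F} is the finite type of polynomials of size at most n.+1,
   i.e., of degree at most n. *)
Definition monic_le (F : finFieldType) (n : nat) : {set {poly_n.+1 F}} :=
  [set p : {poly_n.+1 F} | (p : {poly F}) \is monic].

Definition num_factorizations (F : finFieldType) (n : nat) (s : {poly F}) : nat :=
  #|[set uv : {poly_n.+1 F} * {poly_n.+1 F} |
      [&& uv.1 \in monic_le F n, uv.2 \in monic_le F n
        & s == (uv.1 : {poly F}) * (uv.2 : {poly F})]]|.

Definition max_factorizations (F : finFieldType) (n : nat) : nat :=
  (\max_(s in monic_le F (2 * n)) num_factorizations n (s : {poly F}))%N.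

Definition logb (R : realType) (b x : R) : R := ln x / ln b.

(* Main.v *)
Require Import Defs.
From mathcomp Require Import all_boot all_order all_algebra all_fingroup all_solvable all_field.
From mathcomp Require Import qpoly.
From mathcomp Require Import reals exp ring lra zify.

Set Implicit Arguments.
Unset Strict Implicit.
Unset Printing Implicit Defensive.

Import Order.TTheory GRing.Theory Num.Theory.

Local Open Scope ring_scope.

(* Let q = #|F| and let d be least with q^d >= 2n, so that d <= log_q n + 2.
   Every element of the extension L of F of degree d is a root of a monic
   irreducible polynomial over F of degree at most d, so there are at least
   q^d / d >= 2n/d such polynomials.  With m = n %/ d, take s to be the product
   of 2m of them: each m-subset A yields the factorization of s into the product
   over A and the product over its complement, whence 'C(2m, m) >= 4^m / (2m + 1)
   factorizations.  The logarithmic losses are absorbed by the error term because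
   (log_2 n)^3 = O(n); when log_q n <= 122 the lower bound is nonpositive. *)

(** * Finite extensions of every degree *)

Lemma natr_card_finField (F : finFieldType) : #|F|%:R = 0 :> F.
Proof. by rewrite -FinRing.zmodXgE -cardsT expg_cardG ?inE. Qed.

(** The splitting field L of X^(q^d) - X works: the roots are distinct and form a subfield, hence
    all of L, so L has exactly q^d elements. *)
Lemma fieldExt_of_dim (F : finFieldType) (d : nat) :
  (0 < d)%N -> exists L : splittingFieldType F, \dim {:L} = d.
Proof.
move=> d_gt0; set q := #|F|; have q_gt1 : (1 < q)%N := finNzRing_gt1 F.
have qd_gt1 : (1 < q ^ d)%N by rewrite -(expn0 q) ltn_exp2l.
pose P (R : nzRingType) : {poly R} := 'X^(q ^ d) - 'X.
have sizeP (R : nzRingType) : size (P R) = (q ^ d).+1.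
  by rewrite size_polyDl size_polyXn // size_polyN size_polyX.
have P_neq0 : P F != 0 by rewrite -size_poly_eq0 sizeP.
have [L splitL] := FinSplittingFieldFor P_neq0.
rewrite [map_poly _ _]rmorphB rmorphXn /= map_polyX -/(P L) in splitL.
exists L; have [zs DqL defL] := splitL.
have [a _ Da] := finField_galois_generator (sub1v {:L}).
have {}Da x : a x = x ^+ q by rewrite Da ?memvf // dimv1 expn1.
(* Em, the fixed field of the d-th power of Frobenius, is the set of roots of P L. *)
pose Em := fixedSpace (a ^+ d)%g.
(* Separability: with q^d = m + 2 the polynomial is X (X^(m+1) - 1), and m + 1 = -1 is nonzero in L
   because q^d = 0 there. *)
have Uzs : uniq zs.
  rewrite -separable_prod_XsubC -(eqp_separable DqL) /P.
  have : (q ^ d)%:R = 0 :> L.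
    rewrite natrX -[q%:R]scaler_nat natr_card_finField scale0r.
    by rewrite expr0n gtn_eqF.
  case: (q ^ d)%N qd_gt1 => [|[|m]] // _ m_eq0.
  have -> : 'X^(m.+2) - 'X = ('X^(m.+1) - 1) * ('X - 0) :> {poly L}.
    by rewrite subr0 mulrBl mul1r -exprSr.
  rewrite separable_root andbC /root !hornerE subr_eq0 eq_sym expr0n oner_eq0 /=.
  rewrite cyclotomic.separable_Xn_sub_1 //.
  have -> : m.+1%:R = -1 :> L by apply/eqP; rewrite -addr_eq0 natr1 m_eq0.
  by rewrite oppr_eq0 oner_eq0.
have in_zs : zs =i Em.
  move=> z; rewrite -root_prod_XsubC -(eqp_root DqL) (sameP fixedSpaceP eqP).
  rewrite /root !hornerE subr_eq0 /=; congr (_ == z).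
  elim: (d) => [|i IHi]; first by rewrite gal_id.
  by rewrite expgSr expnSr exprM IHi galM ?Da ?memvf.
(* The roots [zs] generate L and all lie in the subfield [Em]. *)
have defEm : Em = {:L}%VS.
  apply/eqP; rewrite eqEsubv subvf -defL -[Em]subfield_closed agenvS //.
  by rewrite subv_add sub1v; apply/span_subvP=> z; rewrite in_zs.
apply: (expnI q_gt1); apply: succn_inj.
have -> : (q ^ \dim {:L})%N = size zs.
  have /card_uniqP <- : uniq (zs : seq (finvect_type L)) by [].
  rewrite -(card_vspace (T := finvect_type L)).
  by apply: eq_card => x; rewrite in_zs defEm.
by rewrite -(size_prod_XsubC _ id) -(eqp_size DqL) sizeP.
Qed.

(** * Counting irreducible polynomials of bounded degree *)

Lemma size_prod_le_sum (R : nzSemiRingType) (I : Type) (r : seq I) (P : pred I)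
    (f : I -> {poly R}) (d : nat) :
    (forall i, P i -> size (f i) <= d.+1)%N ->
  (size (\prod_(i <- r | P i) f i)%R <= (\sum_(i <- r | P i) d).+1)%N.
Proof.
move=> size_f; elim/big_ind2: _ => [|p a q b size_p size_q|i /size_f //].
  by rewrite size_poly1.
apply: leq_trans (size_polyMleq _ _) _; rewrite -subn1 leq_subLR.
by apply: leq_trans (leq_add size_p size_q) _; rewrite addSn addnS add1n.
Qed.

(** Take the distinct minimal polynomials of the elements of an extension of degree d. Their product
    vanishes at all q^d elements, and its degree is at most d times their number. *)
Lemma many_irreducible (F : finFieldType) (d : nat) : (0 < d)%N ->
  exists ps : seq {poly F},
    [/\ uniq ps, {in ps, forall p, irreducible_poly p},
        {in ps, forall p, p \is monic /\ (size p <= d.+1)%N}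
      & (#|F| ^ d <= size ps * d)%N].
Proof.
case/(fieldExt_of_dim F) => L dimL.
(* [minPoly 1 x] has coefficients in L; they lie in the base field, so it descends to F. *)
have minF (x : L) : {p : {poly F} | map_poly (in_alg L) p == minPoly 1 x}.
  by apply: sigW; have /polyOver1P[p ->] := minPolyOver 1 x; exists p.
pose f x := sval (minF x).
have fE x : map_poly (in_alg L) (f x) = minPoly 1 x by apply/eqP/(svalP (minF x)).
have mon_f x : f x \is monic.
  by rewrite -(map_monic (in_alg L)) fE monic_minPoly.
have size_f x : (1 < size (f x) <= d.+1)%N.
  rewrite -(size_map_poly (in_alg L)) fE size_minPoly !ltnS /=.
  have := dim_Fadjoin 1 x; rewrite dimv1 muln1 => <-.
  by rewrite -dimL dimvS ?subvf.
have irr_f x : irreducible_poly (f x).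
  split=> [|g g_neq1]; first by case/andP: (size_f x).
  rewrite -(dvdp_map (in_alg L)) -(eqp_map (in_alg L)) fE => g_dvd.
  have /orP[//|g_eqp1] : _ := minPoly_irr (alg_polyOver 1 g) g_dvd.
  by rewrite -(size_map_poly (in_alg L)) (eqp_size g_eqp1) size_poly1 in g_neq1.
pose ps := undup (map f (enum (finvect_type L))).
have ps_f p : p \in ps -> exists x, p = f x.
  by rewrite mem_undup => /mapP[x _ ->]; exists x.
exists ps; split; first exact: undup_uniq.
- by move=> p /ps_f[x ->].
- by move=> p /ps_f[x ->]; rewrite mon_f; case/andP: (size_f x).
pose Q : {poly L} := \prod_(p <- ps) map_poly (in_alg L) p.
have Q_neq0 : Q != 0.
  rewrite prodf_seq_neq0; apply/allP => p /ps_f[x ->] /=.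
  by rewrite map_poly_eq0 monic_neq0.
have size_Q : (size Q <= (size ps * d).+1)%N.
  apply: (@leq_trans (\sum_(p <- ps | p \in ps) d).+1); last first.
    by rewrite -big_seq big_const_seq count_predT iter_addn_0 mulnC.
  rewrite /Q big_seq; apply: size_prod_le_sum => p /ps_f[x ->].
  by rewrite size_map_poly; case/andP: (size_f x).
have -> : (#|F| ^ d)%N = size (enum (finvect_type L)).
  rewrite -cardE -dimL -(card_vspace (T := finvect_type L)).
  by apply: eq_card => x; rewrite memvf.
rewrite -ltnS; apply: leq_trans size_Q; apply: max_poly_roots Q_neq0 _ _.
  apply/allP => x _; apply/rootP; rewrite /Q horner_prod.
  apply/eqP; rewrite prodf_seq_eq0; apply/hasP; exists (f x).
    rewrite mem_undup; apply: map_f.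
    exact: etrans (mem_enum (finvect_type L) x) _.
  by rewrite /= fE minPolyxx.
exact: enum_uniq.
Qed.

(** * Factorizations indexed by subsets of irreducibles *)

(** Distinct monic irreducibles are coprime. This lets a subset be recovered from its product. *)
Lemma irreducible_dvd_prod (F : fieldType) (I : finType) (f : I -> {poly F})
    (A : {set I}) (i : I) :
    injective f -> (forall j, irreducible_poly (f j)) -> (forall j, f j \is monic) ->
  (f i %| \prod_(j in A) f j) = (i \in A).
Proof.
move=> f_inj irr_f mon_f; apply/idP/idP => [dvd_f | iA]; last first.
  by rewrite (bigD1 i) //= dvdp_mulr.
apply: contraLR dvd_f => iNA; have [size_fi dvd_fi] := irr_f i.
suff co_f : coprimep (f i) (\prod_(j in A) f j).
  apply/negP => /(coprimep_dvdl)/(_ co_f); rewrite coprimepp => /eqP size1.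
  by rewrite size1 in size_fi.
rewrite big_seq_cond.
elim/big_ind: _ => [|p q co_p co_q|j jA]; first exact: coprimep1.
  by rewrite coprimepMr co_p.
(* A nontrivial gcd is associate to [f i], so [f i] divides [f j]; both being monic irreducible,
   they are equal and i = j. *)
apply: contraR iNA; rewrite coprimep_def => /dvd_fi /(_ (dvdp_gcdl _ _)) eqp_i.
have [_ /(_ (f i))] := irr_f j; rewrite gtn_eqF // -(eqp_dvdl _ eqp_i) dvdp_gcdr.
move=> /(_ isT isT); rewrite eqp_monic // => /eqP/f_inj ->.
by case/andP: jA.
Qed.

Lemma bin_le_max_factorizations (F : finFieldType) (n d m : nat)
    (ps : seq {poly F}) :
    uniq ps -> {in ps, forall p, irreducible_poly p} ->
    {in ps, forall p, p \is monic /\ (size p <= d.+1)%N} ->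
    (2 * m <= size ps)%N -> (m * d <= n)%N ->
  ('C(2 * m, m) <= max_factorizations F n)%N.
Proof.
move=> uniq_ps irr_ps mon_ps size_ps md_le.
pose f (i : 'I_(2 * m)) := ps`_i.
have f_ps i : f i \in ps by rewrite mem_nth // (leq_trans (ltn_ord i)).
have f_inj : injective f.
  move=> i j /eqP; rewrite nth_uniq ?(leq_trans (ltn_ord _)) // => /eqP.
  exact: val_inj.
have irr_f i := irr_ps _ (f_ps i).
have [mon_f size_f] := all_and2 (fun i => mon_ps _ (f_ps i)).
pose u (A : {set 'I_(2 * m)}) := \prod_(i in A) f i.
have mon_u A : u A \is monic by apply: monic_prod => i _.
(* Used with k = 1 for the two factors and k = 2 for [s], so that [npolyp] leaves them unchanged. *)
have size_u (A : {set 'I_(2 * m)}) k : (#|A| = k * m -> size (u A) <= (k * n).+1)%N.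
  move=> cardA; apply: leq_trans (size_prod_le_sum _ _) _; first by move=> i _.
  by rewrite sum_nat_const cardA ltnS -mulnA leq_mul2l md_le orbT.
pose s := npolyp (2 * n).+1 (u [set: 'I_(2 * m)]).
have sE : s = u [set: 'I_(2 * m)] :> {poly F}.
  by rewrite npolypK // size_u // cardsT card_ord.
have mon_s : s \in monic_le F (2 * n) by rewrite inE sE.
apply: (bigop.bigmax_sup s) => //.
pose g A := (npolyp n.+1 (u A), npolyp n.+1 (u (~: A))).
rewrite -[X in 'C(X, _)]card_ord -card_draws.
have gE (A : {set 'I_(2 * m)}) : #|A| = m ->
    (npolyp n.+1 (u A) = u A :> {poly F}) *
    (npolyp n.+1 (u (~: A)) = u (~: A) :> {poly F}).
  move=> cardA; split; apply: npolypK; rewrite -[n]mul1n size_u // mul1n //.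
  by rewrite cardsCs setCK card_ord cardA mul2n -addnn addnK.
(* [g] is injective on m-subsets: the divisors [f i] of the first factor already determine A. *)
rewrite -(@card_in_imset _ _ g) => [|A B]; last first.
  rewrite !inE => /eqP cardA /eqP cardB [] /(congr1 val) /= gAB _.
  apply/setP => i; rewrite -!(irreducible_dvd_prod _ _ f_inj irr_f mon_f).
  by rewrite -/(u A) -(gE A cardA) gAB (gE B cardB).
apply/subset_leq_card/subsetP => _ /imsetP[A + ->]; rewrite 2!inE => /eqP cardA.
rewrite !inE /= !(gE A cardA) !mon_u /= sE /u (big_setID A) /=.
by rewrite setTI setTD.
Qed.

Lemma max_factorizations_ge (F : finFieldType) (n d : nat) :
    (0 < d)%N -> (2 * n <= #|F| ^ d)%N ->
  ('C(2 * (n %/ d), n %/ d) <= max_factorizations F n)%N.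
Proof.
move=> d_gt0 n_le.
have [ps [uniq_ps irr_ps mon_ps size_ps]] := many_irreducible F d_gt0.
apply: (bin_le_max_factorizations uniq_ps irr_ps mon_ps); last exact: leq_divM.
rewrite -(leq_pmul2r d_gt0) -mulnA; apply: leq_trans size_ps.
by apply: leq_trans n_le; rewrite leq_mul2l leq_divM orbT.
Qed.

(** * Estimates for logarithms and central binomial coefficients *)

Lemma half_le_ln2 (R : realType) : 2^-1 <= ln 2 :> R.
Proof.
have := @le_ln1Dx R (- 2^-1); rewrite (_ : 1 - 2^-1 = 2^-1); last by lra.
rewrite lnV ?posrE // => /(_ ltac:(lra)); lra.
Qed.

(** The cubic term of the exponential series gives (ln n)^3 <= 6n, and ln 2 >= 1/2 gives log_2 n <=
    2 ln n; hence 48 = 6 * 2^3. *)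
Lemma cube_logb_le (R : realType) (n : nat) : (0 < n)%N ->
  logb 2 n%:R ^+ 3 <= 48 * n%:R :> R.
Proof.
move=> n_gt0; have n_ge1 : 1 <= n%:R :> R by rewrite ler1n.
have ln2 := half_le_ln2 R; have l_ge0 := ln_ge0 n_ge1.
have := expR_ge1Dxn 2 l_ge0; rewrite lnK ?posrE ?ltr0n // => exp_ge.
have t_ge0 : 0 <= logb 2 n%:R :> R by rewrite divr_ge0 //; lra.
have t_le : logb 2 n%:R <= 2 * ln n%:R :> R.
  rewrite ler_pdivrMr; last by apply: lt_le_trans ln2; lra.
  by nra.
have : logb 2 n%:R ^+ 3 <= (2 * ln n%:R) ^+ 3 :> R by rewrite lerXn2r ?nnegrE //; lra.
rewrite [(2 * _) ^+ 3]exprMn; move: exp_ge; rewrite (_ : 3`! = 6)%N //.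
set x := logb _ _ ^+ 3; set y := ln _ ^+ 3; lra.
Qed.

(** Here L is log_q n and t is log_2 n. With n = a L^2, the left side is 2aL - 244a. On the right, L
    + 2 in place of L costs at most 4a, and 4 + t <= 2t <= 96a. *)
Lemma main_term_le (R : realFieldType) (L t n : R) :
    122 < L -> L <= t -> t ^+ 3 <= 48 * n ->
  2 * n / L * (1 - 122 / L) <= 2 * (n / (L + 2)) - 4 - t.
Proof.
move=> L_gt t_ge cube_le; have L_neq0 : L != 0 by apply/eqP; lra.
have [a nE] : exists a, n = a * L ^+ 2.
  by exists (n / L ^+ 2); rewrite divfK ?expf_neq0.
have t_le : t <= 48 * a.
  have L2_gt0 : 0 < L ^+ 2 by rewrite exprn_gt0 //; lra.
  rewrite -(ler_pM2r L2_gt0) -mulrA -nE; apply: le_trans cube_le.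
  by rewrite [t ^+ 3]exprS ler_pM2l ?lerXn2r ?nnegrE //; lra.
have -> : 2 * n / L * (1 - 122 / L) = 2 * a * (L - 122) by rewrite nE; field.
have : a * (L - 2) <= n / (L + 2) by rewrite ler_pdivlMr ?nE; nra.
lra.
Qed.

(** By minimality q^(d-1) < 2n, so d - 1 <= log_q n + log_q 2, and log_q 2 <= 1. *)
Lemma logb_up_log_le (R : realType) (q n : nat) : (1 < q)%N -> (0 < n)%N ->
  (up_log q (2 * n))%:R <= logb q%:R n%:R + 2 :> R.
Proof.
move=> q_gt1 n_gt0; have n2_gt1 : (1 < 2 * n)%N by lia.
have lnq_gt0 : 0 < ln q%:R :> R by rewrite ln_gt0 // ltr1n.
have := up_log_gtn q_gt1 n2_gt1.
have: (0 < up_log q (2 * n))%N by rewrite up_log_gt0 q_gt1.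
case: (up_log _ _) => // k _ /= /ltnW; rewrite -(ler_nat R).
rewrite -[_ <= (2 * n)%:R]ler_ln ?posrE ?ltr0n ?expn_gt0
  ?(ltnW q_gt1) ?(ltnW n2_gt1) //.
rewrite natrX lnXn ?ltr0n ?(ltnW q_gt1) // natrM lnM ?posrE ?ltr0n // => k_le.
have ln2q : ln 2 <= ln q%:R :> R by rewrite ler_ln ?posrE ?ltr0n ?ler_nat // ltnW.
rewrite /logb -natr1 -lerBlDr ler_pdivlMr //; move: k_le; rewrite -[_ *+ k]mulr_natl.
lra.
Qed.

(** Induction on m: the central coefficient grows by the factor 2(2m + 1)/(m + 1). *)
Lemma central_bin_ge (m : nat) : (4 ^ m <= (2 * m).+1 * 'C(2 * m, m))%N.
Proof.
elim: m => [|m IHm] //.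
have binS : (m.+1 * 'C(2 * m.+1, m.+1) = 2 * (2 * m).+1 * 'C(2 * m, m))%N.
  have binD := mul_bin_diag (2 * m).+2 m; have binL := mul_bin_down (2 * m).+1 m.
  rewrite /= in binD binL; rewrite mulnS -binD -mulnA binL; nia.
rewrite -(leq_pmul2l (ltn0Sn m)) mulnCA binS expnS.
apply: (@leq_trans (m.+1 * (4 * ((2 * m).+1 * 'C(2 * m, m))))).
  by rewrite !leq_mul2l IHm !orbT.
nia.
Qed.

Lemma logb_central_bin_ge (R : realType) (n m : nat) : (0 < n)%N -> (m <= n)%N ->
  2 * m%:R - 2 - logb 2 n%:R <= logb 2 'C(2 * m, m)%:R :> R.
Proof.
move=> n_gt0 m_le; have ln2 := half_le_ln2 R.
have C_gt0 : (0 < 'C(2 * m, m))%N by rewrite bin_gt0 mul2n -addnn leq_addr.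
(* The factor 2m + 1 is at most 4n, whose binary logarithm is 2 + log_2 n. *)
have : (2 ^ (2 * m) <= 2 ^ 2 * n * 'C(2 * m, m))%N.
  rewrite expnM; apply: leq_trans (central_bin_ge m) _.
  by rewrite leq_mul2r; apply/orP; right; lia.
rewrite -(ler_nat R) -[(2 ^ _)%:R <= _]ler_ln ?posrE ?ltr0n ?muln_gt0 ?expn_gt0 ?n_gt0 //.
rewrite !natrM !lnM ?posrE ?mulr_gt0 ?ltr0n ?expn_gt0 ?n_gt0 //.
rewrite !natrX !lnXn // => le_ln.
rewrite ler_pdivlMr; last by lra.
rewrite !mulrBl divfK; last by rewrite gt_eqF; lra.
move: le_ln; rewrite -[_ *+ (2 * m)]mulr_natl natrM; lra.
Qed.

Theorem theorem2 (R : realType) :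
  exists C : R, 0 < C /\
    forall (F : finFieldType) (n : nat), (0 < n)%N ->
      2 * n%:R / logb (#|F|%:R : R) n%:R * (1 - C / logb (#|F|%:R : R) n%:R)
        <= logb 2 (max_factorizations F n)%:R.
Proof.
exists 122; split=> [|F n n_gt0]; first by rewrite ltr0n.
have q_gt1 : (1 < #|F|)%N := finNzRing_gt1 F; have ln2 := half_le_ln2 R.
have lnq_ge : ln 2 <= ln #|F|%:R :> R.
  by rewrite ler_ln ?posrE ?ltr0n ?ler_nat // ltnW.
have lnn_ge0 : 0 <= ln n%:R :> R by rewrite ln_ge0 // ler1n.
set L := logb _ n%:R; have L_ge0 : 0 <= L by rewrite divr_ge0 //; lra.
have [L_le|L_gt] := lerP L 122.
  apply: (@le_trans _ _ 0); last first.
    rewrite divr_ge0 //; last by lra.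
    (* At 0 the logarithm takes the default value 0. *)
    case: (max_factorizations F n) => [|M]; first by rewrite ln0.
    by rewrite ln_ge0 // ler1n.
  (* L = 0 occurs for n = 1; division by zero then makes the left side 0. *)
  have [->|L_neq0] := eqVneq L 0; first by rewrite invr0 mulr0 mul0r.
  apply: mulr_ge0_le0; first by rewrite divr_ge0 // mulr_ge0 // ler0n.
  by rewrite subr_le0 ler_pdivlMr ?mul1r // lt_def L_neq0.
have L_le : L <= logb 2 n%:R.
  by rewrite ler_wpM2l // lef_pV2 ?posrE //; lra.
apply: le_trans (main_term_le L_gt L_le (cube_logb_le R n_gt0)) _.
pose d := up_log #|F| (2 * n); pose m := (n %/ d)%N.
have d_le : d%:R <= L + 2 := logb_up_log_le R q_gt1 n_gt0.
have d_gt0 : (0 < d)%N by rewrite up_log_gt0 q_gt1; lia.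
have m_le : (m <= n)%N := leq_div n d.
have bin_le := max_factorizations_ge d_gt0 (up_logP (2 * n) q_gt1).
have C_gt0 : (0 < 'C(2 * m, m))%N by rewrite bin_gt0 mul2n -addnn leq_addr.
apply: (@le_trans _ _ (logb 2 'C(2 * m, m)%:R)); last first.
  apply: ler_wpM2r; first by rewrite invr_ge0; lra.
  by rewrite ler_ln ?posrE ?ltr0n ?ler_nat // (leq_trans C_gt0).
apply: le_trans (logb_central_bin_ge R n_gt0 m_le).
(* Rounding n/d down costs at most 1, so 2 in 2m; with the 2 from log_2 (4n) this is the 4 in
   [main_term_le]. *)
suff : n%:R / (L + 2) <= m%:R + 1 by lra.
rewrite ler_pdivrMr; last by lra.
apply: (@le_trans _ _ ((m%:R + 1) * d%:R)).
  by rewrite natr1 -natrM ler_nat ltnW // ltn_ceil.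
by rewrite ler_wpM2l // addr_ge0.
Qed.
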